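(* Assume: (BoS) for each $d\in\mathcal D$, $\mathrm{Supp}(Y_d\mid D\ne d)=\mathrm{Supp}(Y_d\mid D=d)=[\underline y_d,\overline y_d]$ with $\underline y_d,\overline y_d\in\mathbb R$; (SDC) $\mathrm{Cov}(Y_d,D)\,\mathrm{Cov}(Y_d,Z)\ge 0$ for each $d\in\mathcal D$. Then for each $d\in\mathcal D$, the potential outcome mean $\theta_d=\mathrm{E}[Y_d]$ satisfies $\theta_d\in I^d_{SDC}:= I^d_{SDC1}\cup I^d_{SDC2}$, where $$I_{SDC1}^d=\Big[\sup_{(\alpha,\beta)\in[0,1]^2}\mathrm{E}\big[\underline f_d(Y,D,\delta_S^-)\big],\ \inf_{(\alpha,\beta)\in[0,1]^2}\mathrm{E}\big[\overline f_d(Y,D,\delta_S^+)\big]\Big],$$ $$I_{SDC2}^d=\Big[\sup_{(\alpha,\beta)\in[0,1]^2}\mathrm{E}\big[\underline f_d(Y,D,\delta_S^+)\big],\ \inf_{(\alpha,\beta)\in[0,1]^2}\mathrm{E}\big[\overline f_d(Y,D,\delta_S^-)\big]\Big].$$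
   Context: Setting: all random variables live on one probability space. $D$ is a discrete random variable (treatment) with values in $\mathcal D=\{1,\dots,T\}$; for each $d\in\mathcal D$, $Y_d$ is an integrable real random variable (potential outcome); the observed outcome is $Y=\sum_{d=1}^T Y_d\,\mathbf 1\{D=d\}$; $Z$ is an integrable real random variable (imperfect instrument). Write $\tilde D=D-\mathrm{E}[D]$, $\tilde Z=Z-\mathrm{E}[Z]$. For $(\alpha,\beta)\in[0,1]^2$ define $\delta_S^{+}=1+\alpha(\beta\tilde D+(1-\beta)\tilde Z)$ and $\delta_S^{-}=1-\alpha(\beta\tilde D+(1-\beta)\tilde Z)$ (random variables depending on $\alpha,\beta$). For real (or random) $\delta$ define $$\underline f_d(Y,D,\delta)=\mathbf 1\{D=d\}\,\delta Y+\mathbf 1\{D\ne d\}\min\{\delta\underline y_d,\delta\overline y_d\},$$ $$\overline f_d(Y,D,\delta)=\mathbf 1\{D=d\}\,\delta Y+\mathbf 1\{D\ne d\}\max\{\delta\underline y_d,\delta\overline y_d\}.$$ Here $\mathrm{Supp}(Y_d\mid A)$ is the support of the conditional distribution of $Y_d$ given the event $A$ (assumed of positive probability). An interval $[a,b]$ with $a>b$ is the empty set. *)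

(* Defs.v *)
From HB Require Import structures.
From mathcomp Require Import all_boot all_order all_algebra.
From mathcomp Require Import all_classical all_reals all_analysis.

Set Implicit Arguments.
Unset Strict Implicit.
Unset Printing Implicit Defensive.

Import Order.TTheory GRing.Theory Num.Theory.
Import numFieldNormedType.Exports.

Local Open Scope classical_set_scope.
Local Open Scope ring_scope.

(* Meaningful only when [A] has positive probability. *)
Definition cond_prob d (Omega : measurableType d) (R : realType)
    (P : probability Omega R) (A B : set Omega) : \bar R :=
  (P (B `&` A) / P A)%E.

Definition cond_distribution d (Omega : measurableType d) (R : realType)
    (P : probability Omega R) (X : {RV P >-> R}) (A : set Omega) :
    set R -> \bar R :=
  pushforward (cond_prob P A) X.

Definition support (R : realType) (mu : set R -> \bar R) : set R :=
  [set y | forall U : set R, open U -> U y -> (0 < mu U)%E].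

Definition cond_support d (Omega : measurableType d) (R : realType)
    (P : probability Omega R) (X : {RV P >-> R}) (A : set Omega) : set R :=
  support (cond_distribution X A).

Section Model.
Context (disp : measure_display) (Omega : measurableType disp) (R : realType).
Variable P : probability Omega R.

(* The treatment is a real-valued random variable whose values are the numbers
   [d%:R] with [1 <= d <= T]. Potential outcomes are indexed by all of [nat];
   only the indices [1 <= d <= T] are ever used. *)
Definition treatment_eq (D : {dRV P >-> R}) (d : nat) : set Omega :=
  [set w | D w = d%:R].

Definition observed (T : nat) (D : {dRV P >-> R})
    (Yp : nat -> {RV P >-> R}) : Omega -> R :=
  fun w => \sum_(1 <= d < T.+1) Yp d w * \1_(treatment_eq D d) w.

Definition centered (X : Omega -> R) : Omega -> R :=
  fun w => X w - fine ('E_P[X])%E.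

Definition deltaS_plus (D : {dRV P >-> R}) (Z : {RV P >-> R})
    (ab : R * R) : Omega -> R :=
  fun w => 1 + ab.1 * (ab.2 * centered D w + (1 - ab.2) * centered Z w).

Definition deltaS_minus (D : {dRV P >-> R}) (Z : {RV P >-> R})
    (ab : R * R) : Omega -> R :=
  fun w => 1 - ab.1 * (ab.2 * centered D w + (1 - ab.2) * centered Z w).

Definition f_lower (yl yu : R) (d : nat) (Y : Omega -> R) (D : {dRV P >-> R})
    (delta : Omega -> R) : Omega -> R :=
  fun w => \1_(treatment_eq D d) w * (delta w * Y w)
         + \1_(~` treatment_eq D d) w * Num.min (delta w * yl) (delta w * yu).

Definition f_upper (yl yu : R) (d : nat) (Y : Omega -> R) (D : {dRV P >-> R})
    (delta : Omega -> R) : Omega -> R :=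
  fun w => \1_(treatment_eq D d) w * (delta w * Y w)
         + \1_(~` treatment_eq D d) w * Num.max (delta w * yl) (delta w * yu).

Definition unit_square : set (R * R) := `[0, 1]%classic `*` `[0, 1]%classic.

(* Suprema, infima and intervals are taken in the extended reals, where the
   supremum and the infimum of a set always exist. An interval whose lower
   bound exceeds its upper bound is empty. *)
Definition I_SDC1 (yl yu : R) (d : nat) (Y : Omega -> R)
    (D : {dRV P >-> R}) (Z : {RV P >-> R}) : set (\bar R) :=
  `[ereal_sup [set 'E_P[f_lower yl yu d Y D (deltaS_minus D Z ab)]
                | ab in unit_square]%E,
    ereal_inf [set 'E_P[f_upper yl yu d Y D (deltaS_plus D Z ab)]
                | ab in unit_square]%E]%classic.

Definition I_SDC2 (yl yu : R) (d : nat) (Y : Omega -> R)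
    (D : {dRV P >-> R}) (Z : {RV P >-> R}) : set (\bar R) :=
  `[ereal_sup [set 'E_P[f_lower yl yu d Y D (deltaS_plus D Z ab)]
                | ab in unit_square]%E,
    ereal_inf [set 'E_P[f_upper yl yu d Y D (deltaS_minus D Z ab)]
                | ab in unit_square]%E]%classic.

Definition I_SDC (yl yu : R) (d : nat) (Y : Omega -> R)
    (D : {dRV P >-> R}) (Z : {RV P >-> R}) : set (\bar R) :=
  I_SDC1 yl yu d Y D Z `|` I_SDC2 yl yu d Y D Z.

End Model.

(* Main.v *)
Require Import Defs.
From HB Require Import structures.
From mathcomp Require Import all_boot all_order all_algebra.
From mathcomp Require Import all_classical all_reals all_analysis.
From mathcomp Require Import measurable_realfun ring.

Set Implicit Arguments.
Unset Strict Implicit.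
Unset Printing Implicit Defensive.

Import Order.TTheory GRing.Theory Num.Theory.
Import numFieldNormedType.Exports.

Local Open Scope classical_set_scope.
Local Open Scope ring_scope.

(* The support condition makes Y_d take almost surely its values in
   [yl, yu], so pointwise f_lower <= delta Y_d <= f_upper almost surely, whence
   E[f_lower] <= E[delta Y_d] <= E[f_upper] for every integrable delta. Moreover
   E[delta_S^+/- Y_d] = E[Y_d] +/- alpha (beta Cov(Y_d, D) + (1 - beta) Cov(Y_d, Z)),
   and (SDC) forces the two covariances to have a common sign: the first interval
   applies when both are nonnegative, the second when both are nonpositive. *)

(* The complement of the support is covered by the countably many rational
   balls that are null for the conditional distribution. *)
Lemma cond_support_ae disp (Omega : measurableType disp) (R : realType)
    (P : probability Omega R) (X : {RV P >-> R}) (A : set Omega) :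
  measurable A -> (0 < P A)%E ->
  {ae P, forall w, A w -> cond_support X A (X w)}.
Proof.
move=> mA PA_gt0.
pose V (p : rat * rat) := X @^-1` ball (ratr p.1 : R) (ratr p.2) `&` A.
(* [unpickle] enumerates the pairs of rationals as a sequence; an index that decodes to no pair, or
   to a ball with [P (V p)] nonzero, contributes the empty set. *)
pose F n : set Omega :=
  if unpickle n is Some p then if P (V p) == 0%E then V p else set0 else set0.
have mV p : measurable (V p).
  apply: measurableI => //.
  by apply: measurable_funPTI; apply: open_measurable; apply: ball_open.
have negF n : P.-negligible (F n).
  rewrite /F; case: unpickle => [p|]; last exact: negligible_set0.
  by case: eqP => [PV0|_]; [exact/negligibleP|exact: negligible_set0].
apply: negligibleS (negligible_bigcup negF) => w /= /not_implyP[Aw].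
move=> /existsNP[U /not_implyP[oU /not_implyP[UXw muU]]].
have [c [r [/set_mem Bw BU]]] := open_subball_rat oU (mem_set UXw).
exists (pickle (c, r)); first exact: I.
rewrite /F pickleK.
suff -> : P (V (c, r)) == 0%E by split.
have mU : measurable (X @^-1` U `&` A).
  apply: measurableI; last exact: mA.
  by apply: measurable_funPTI; apply: open_measurable; exact: oU.
apply/eqP; apply: (subset_measure0 (mV (c, r)) mU).
  by apply: setSI => v /=; exact: BU.
(* Dividing by [P A], which is positive and finite, preserves strict positivity, so a positive [P]
   here would give [U] positive conditional mass. *)
apply/eqP; rewrite -measure_le0 leNgt; apply/negP => PU_gt0.
apply: muU; rewrite /cond_distribution /pushforward /cond_prob.
have PA_fin : (P A < +oo)%E by rewrite (le_lt_trans (probability_le1 P mA))// ltry.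
by apply: mule_gt0 => //; rewrite inve_gt0// ?(gt_eqF PA_gt0)// (lt_eqF PA_fin).
Qed.

(** * Integrability and expectations under almost sure bounds *)

Section ae_expectation.
Context disp (Omega : measurableType disp) (R : realType).
Variable P : probability Omega R.

Lemma Lfun1_measurable (X : Omega -> R) : X \in Lfun P 1 ->
  measurable_fun setT X.
Proof. by move/Lfun1_integrable/measurable_int/measurable_EFinP. Qed.

Lemma ae_le_Lfun1 (X W : Omega -> R) : measurable_fun setT X ->
  W \in Lfun P 1 -> {ae P, forall w, `|X w| <= `|W w|} -> X \in Lfun P 1.
Proof.
move=> mX LW XW; apply/Lfun1_integrable/integrableP.
have mW := Lfun1_measurable LW.
split; first exact/measurable_EFinP.
have /Lfun1_integrable/integrableP[_] := LW; apply: le_lt_trans.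
apply: ae_ge0_le_integral => //.
- by apply: measurableT_comp => //; exact/measurable_EFinP.
- by apply: measurableT_comp => //; exact/measurable_EFinP.
- by apply: filterS XW => w XWw _ /=; rewrite lee_fin.
Qed.

(** The difference [W \- X] agrees almost surely with its absolute value, whose integral is
    nonnegative. *)
Lemma ae_le_expectation (X W : Omega -> R) : X \in Lfun P 1 ->
  W \in Lfun P 1 -> {ae P, forall w, X w <= W w} -> ('E_P[X] <= 'E_P[W])%E.
Proof.
move=> LX LW XW.
rewrite -sube_ge0 ?expectation_fin_num// -expectationB//.
have mB : measurable_fun setT (W \- X).
  by apply: measurable_funB; exact: Lfun1_measurable.
rewrite unlock (@ae_eq_integral _ _ _ _ _ (fun w => `|(W \- X) w|%:E))//.
- by apply: integral_ge0.
- exact/measurable_EFinP.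
- by apply/measurable_EFinP; apply: measurableT_comp.
- by apply: filterS XW => w XWw _ /=; rewrite ger0_norm// subr_ge0.
Qed.

Lemma ae_bounded_mul_Lfun1 (X W : Omega -> R) (M : R) :
  measurable_fun setT X -> W \in Lfun P 1 ->
  {ae P, forall w, `|X w| <= M} -> X * W \in Lfun P 1.
Proof.
move=> mX LW XM; apply: (@ae_le_Lfun1 _ (M \o* W)).
- by apply: measurable_funM => //; exact: Lfun1_measurable.
- exact: Lfun_scale.
- apply: filterS XM => w XwM /=; rewrite !normrM mulrC ler_wpM2l//.
  exact: le_trans (ler_norm M).
Qed.

Lemma centered_Lfun1 (X : Omega -> R) : X \in Lfun P 1 ->
  centered P X \in Lfun P 1.
Proof.
move=> LX; have -> : centered P X = X \- cst (fine ('E_P[X])%E) by [].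
by rewrite rpredB//= Lfun_cst.
Qed.

(** Centering a single factor suffices, as E[X (W - E[W])] = E[XW] - E[X] E[W]; this is the form
    that arises on expanding E[delta Y_d]. *)
Lemma covariance_centered (X W : Omega -> R) : X \in Lfun P 1 ->
  W \in Lfun P 1 -> X * W \in Lfun P 1 ->
  covariance P X W = ('E_P[X * centered P W])%E.
Proof.
move=> LX LW LXW; rewrite covarianceE//.
have -> : X * centered P W = X * W \- fine ('E_P[W])%E \o* X.
  by apply/funext => w; rewrite /centered !fctE/=; ring.
rewrite expectationB ?Lfun_scale// expectationZl// fineK ?expectation_fin_num//.
by rewrite muleC.
Qed.

End ae_expectation.

(** * Bounds on E[delta Y_d] for an integrable delta *)

Section interval_bounds.
Context disp (Omega : measurableType disp) (R : realType).
Variable P : probability Omega R.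

(** Lets every fact about the weights be proved for [deltaS_plus] alone, with [a] ranging over all
    reals. *)
Lemma deltaS_minusE (D : {dRV P >-> R}) (Z : {RV P >-> R}) (a b : R) :
  deltaS_minus D Z (a, b) = deltaS_plus D Z (- a, b).
Proof. by apply/funext => w; rewrite /deltaS_minus /deltaS_plus/= mulNr. Qed.

(** Duality max(x, y) = -min(-x, -y), by which the upper bounds follow from the lower ones. *)
Lemma f_upperE (yl yu : R) d Y (D : {dRV P >-> R}) (delta : Omega -> R) :
  f_upper yl yu d Y D delta = \- f_lower yl yu d Y D (\- delta).
Proof.
apply/funext => w; rewrite /f_upper /f_lower/=.
by rewrite !mulNr -oppr_max !mulrN -opprD opprK.
Qed.

Lemma observed_eq T (D : {dRV P >-> R}) (Yp : nat -> {RV P >-> R}) d w :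
  (1 <= d <= T)%N -> treatment_eq D d w -> observed T D Yp w = Yp d w.
Proof.
move=> dT Ddw; rewrite /observed (bigD1_seq d)/= ?mem_index_iota ?iota_uniq//.
rewrite indicE mem_set// mulr1 big1 ?addr0// => e ed.
rewrite indicE memNset ?mulr0// /treatment_eq/= Ddw => /eqP.
by rewrite eqr_nat eq_sym (negbTE ed).
Qed.

Lemma treatment_eq_measurable (D : {dRV P >-> R}) d :
  measurable (treatment_eq D d).
Proof.
have -> : treatment_eq D d = D @^-1` [set d%:R] by [].
exact: measurable_funPTI.
Qed.

Lemma observed_measurable T (D : {dRV P >-> R}) (Yp : nat -> {RV P >-> R}) :
  measurable_fun setT (observed T D Yp).
Proof.
apply: measurable_sum => d; apply: measurable_funM => //.
exact/measurable_indic/treatment_eq_measurable.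
Qed.

Lemma treatment_Lfun1 T (D : {dRV P >-> R}) :
  (forall w, exists2 d : nat, (1 <= d <= T)%N & D w = d%:R) ->
  (D : Omega -> R) \in Lfun P 1.
Proof.
move=> DT; apply: (@ae_le_Lfun1 _ _ _ _ _ (cst T%:R)) => //; first exact: Lfun_cst.
apply: aeW => w /=; have [d /andP[_ dT] ->] := DT w.
by rewrite !normr_nat ler_nat.
Qed.

Variables (T : nat) (D : {dRV P >-> R}) (Yp : nat -> {RV P >-> R}).
Variables (yl yu : R) (d : nat).
Hypothesis dT : (1 <= d <= T)%N.
Hypothesis Yd_bounded : {ae P, forall w, yl <= Yp d w <= yu}.

Let M := Num.max `|yl| `|yu|.

Let Yd_le_M : {ae P, forall w, `|Yp d w| <= M}.
Proof.
apply: filterS Yd_bounded => w /andP[ylY Yyu].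
rewrite ler_norml; apply/andP; split.
  rewrite lerNl (le_trans _ (le_trans (ler_norm (- yl)) _)) ?lerN2//.
  by rewrite normrN le_max lexx.
by rewrite (le_trans Yyu)// (le_trans (ler_norm _))// le_max lexx orbT.
Qed.

Lemma mulYd_Lfun1 (W : Omega -> R) : W \in Lfun P 1 ->
  (Yp d : Omega -> R) * W \in Lfun P 1.
Proof. by move=> LW; exact: ae_bounded_mul_Lfun1 Yd_le_M. Qed.

(** Domination by [M] times |delta|: the value is delta times either Y_d or an endpoint, and [M]
    bounds all of these in absolute value, almost surely for Y_d. *)
Lemma f_lower_Lfun1 (delta : Omega -> R) : delta \in Lfun P 1 ->
  f_lower yl yu d (observed T D Yp) D delta \in Lfun P 1.
Proof.
move=> Ldelta; have mdelta := Lfun1_measurable Ldelta.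
apply: (@ae_le_Lfun1 _ _ _ _ _ (M \o* delta)).
- apply: measurable_funD; apply: measurable_funM.
  + exact/measurable_indic/treatment_eq_measurable.
  + by apply: measurable_funM => //; exact: observed_measurable.
  + exact/measurable_indic/measurableC/treatment_eq_measurable.
  + by apply: measurable_minr; apply: measurable_funM.
- exact: Lfun_scale.
have M0 : 0 <= M by rewrite le_max normr_ge0.
apply: filterS Yd_le_M => w YM /=.
rewrite normrM (ger0_norm M0) /f_lower.
have [Dw|nDw] := pselect (treatment_eq D d w).
  rewrite !indicE mem_set// memNset// mul1r mul0r addr0 (observed_eq Yp dT)//.
  by rewrite normrM ler_wpM2l.
rewrite !indicE memNset// mem_set// mul1r mul0r add0r.
by rewrite minEle; case: ifP => _; rewrite normrM ler_wpM2l// le_max lexx ?orbT.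
Qed.

Lemma f_lower_expectation_le (delta : Omega -> R) : delta \in Lfun P 1 ->
  ('E_P[f_lower yl yu d (observed T D Yp) D delta] <=
   'E_P[(Yp d : Omega -> R) * delta])%E.
Proof.
move=> Ldelta;
apply: ae_le_expectation; first exact: f_lower_Lfun1.
- exact: mulYd_Lfun1.
- apply: filterS Yd_bounded => w /andP[ylY Yyu].
  rewrite /f_lower fctE; have [Dw|nDw] := pselect (treatment_eq D d w).
    by rewrite !indicE mem_set// memNset// mul1r mul0r addr0 (observed_eq Yp dT)// mulrC.
  rewrite !indicE memNset// mem_set// mul1r mul0r add0r [leRHS]mulrC ge_min.
  (* The weight may be negative, so its sign decides which endpoint gives the bound: [yl] if
     nonnegative, [yu] otherwise. *)
  have [d0|d0] := leP 0 (delta w); first by rewrite ler_wpM2l.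
  by rewrite [X in _ || X]ler_wnM2l ?orbT// ltW.
Qed.

Lemma f_upper_expectation_ge (delta : Omega -> R) : delta \in Lfun P 1 ->
  ('E_P[(Yp d : Omega -> R) * delta] <=
   'E_P[f_upper yl yu d (observed T D Yp) D delta])%E.
Proof.
move=> Ldelta; have Lopp : \- delta \in Lfun P 1 by rewrite rpredN.
have oppE (X : Omega -> R) : X \in Lfun P 1 -> ('E_P[\- X] = - 'E_P[X])%E.
  move=> LX; have -> : \- X = -1 \o* X by apply/funext => w /=; rewrite mulrN1.
  by rewrite expectationZl// EFinN mulN1e.
rewrite f_upperE oppE ?f_lower_Lfun1// leeNr -oppE ?mulYd_Lfun1//.
have -> : \- ((Yp d : Omega -> R) * delta) = (Yp d : Omega -> R) * \- delta.
  by apply/funext => w /=; rewrite !fctE mulrN.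
exact: f_lower_expectation_le.
Qed.

(** * The expectation of Y_d weighted by delta_S *)

Variable Z : {RV P >-> R}.
Hypothesis LY : (Yp d : Omega -> R) \in Lfun P 1.
Hypothesis LD : (D : Omega -> R) \in Lfun P 1.
Hypothesis LZ : (Z : Omega -> R) \in Lfun P 1.

Let deltaS_plusE (a b : R) : deltaS_plus D Z (a, b) =
  cst 1 \+ a \o* (b \o* centered P D \+ (1 - b) \o* centered P Z).
Proof. by apply/funext => w; rewrite /deltaS_plus/=; ring. Qed.

Lemma deltaS_plus_Lfun1 (a b : R) : deltaS_plus D Z (a, b) \in Lfun P 1.
Proof.
rewrite deltaS_plusE rpredD ?Lfun_cst// Lfun_scale// rpredD//=.
  by rewrite Lfun_scale// centered_Lfun1.
by rewrite Lfun_scale// centered_Lfun1.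
Qed.

(** Linearity turns each centered variable into a covariance with Y_d. These covariances are finite,
    so [fine] loses nothing. *)
Lemma deltaS_plus_expectation (a b : R) :
  ('E_P[((Yp d : Omega -> R) * deltaS_plus D Z (a, b))%R] =
   'E_P[Yp d] + (a * (b * fine (covariance P (Yp d) D) +
                      (1 - b) * fine (covariance P (Yp d) Z)))%:E)%E.
Proof.
have LYD := mulYd_Lfun1 (centered_Lfun1 LD).
have LYZ := mulYd_Lfun1 (centered_Lfun1 LZ).
have -> : (Yp d : Omega -> R) * deltaS_plus D Z (a, b) =
    Yp d \+ a \o* (b \o* ((Yp d : Omega -> R) * centered P D) \+
                  (1 - b) \o* ((Yp d : Omega -> R) * centered P Z)).
  by apply/funext => w; rewrite deltaS_plusE !fctE/=; ring.
have Lsum : b \o* ((Yp d : Omega -> R) * centered P D) \+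
    (1 - b) \o* ((Yp d : Omega -> R) * centered P Z) \in Lfun P 1.
  by rewrite rpredD//= Lfun_scale.
rewrite expectationD ?Lfun_scale// expectationZl// expectationD ?Lfun_scale//.
rewrite !expectationZl// [in RHS]EFinM [in RHS]EFinD !EFinM.
rewrite !fineK ?covariance_fin_num ?mulYd_Lfun1//.
by rewrite !covariance_centered ?mulYd_Lfun1.
Qed.

End interval_bounds.

(** * Common sign of the covariances and the conclusion *)

Lemma mul_ge0_same_sign (R : realDomainType) (x y : R) : 0 <= x * y ->
  (0 <= x /\ 0 <= y) \/ (x <= 0 /\ y <= 0).
Proof.
have [x0|x0|<-] := ltgtP 0 x.
- by rewrite pmulr_rge0// => y0; left; split => //; exact: ltW.
- by rewrite nmulr_rge0// => y0; right; split => //; exact: ltW.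
- by move=> _; case: (leP 0 y) => [y0|/ltW y0]; [left|right].
Qed.

Theorem proposition3p1 (disp : measure_display) (Omega : measurableType disp)
    (R : realType) (P : probability Omega R) (T : nat)
    (D : {dRV P >-> R}) (Yp : nat -> {RV P >-> R}) (Z : {RV P >-> R})
    (yl yu : nat -> R)
    (D_values : forall w, exists2 d : nat, (1 <= d <= T)%N & D w = d%:R)
    (Yp_integrable : forall d : nat, (1 <= d <= T)%N ->
       P.-integrable setT (EFin \o Yp d))
    (Z_integrable : P.-integrable setT (EFin \o Z))
    (pos_eq : forall d : nat, (1 <= d <= T)%N ->
       (0 < P (treatment_eq D d))%E)
    (pos_neq : forall d : nat, (1 <= d <= T)%N ->
       (0 < P (~` treatment_eq D d))%E)
    (BoS : forall d : nat, (1 <= d <= T)%N ->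
       cond_support (Yp d) (~` treatment_eq D d) = `[yl d, yu d]%classic /\
       cond_support (Yp d) (treatment_eq D d) = `[yl d, yu d]%classic)
    (SDC : forall d : nat, (1 <= d <= T)%N ->
       (0 <= covariance P (Yp d) D * covariance P (Yp d) Z)%E) :
  forall d : nat, (1 <= d <= T)%N ->
    I_SDC (yl d) (yu d) d (observed T D Yp) D Z ('E_P[Yp d])%E.
Proof.
move=> d dT.
have LY : (Yp d : Omega -> R) \in Lfun P 1.
  by apply/Lfun1_integrable; exact: Yp_integrable.
have LZ : (Z : Omega -> R) \in Lfun P 1 by exact/Lfun1_integrable.
have LD := treatment_Lfun1 D_values.
have mA := treatment_eq_measurable D d.
(* The event D = d and its complement cover the space, and the conditional support is the same
   interval on both. *)
have Yd_bounded : {ae P, forall w, yl d <= Yp d w <= yu d}.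
  have [suppN suppA] := BoS _ dT.
  have aeA := cond_support_ae (Yp d) mA (pos_eq _ dT).
  have aeN := cond_support_ae (Yp d) (measurableC mA) (pos_neq _ dT).
  rewrite suppA in aeA; rewrite suppN in aeN.
  apply: filterS2 aeA aeN => w YA YN.
  have [/YA|/YN] := pselect (treatment_eq D d w); by rewrite /= in_itv.
have LYX (X : Omega -> R) : X \in Lfun P 1 -> (Yp d : Omega -> R) * X \in Lfun P 1.
  by move=> LX; exact: (mulYd_Lfun1 Yd_bounded LX).
(* The amount by which weighting by [deltaS_plus D Z (a, b)] shifts the mean of Y_d; its sign tells
   which bound holds. *)
pose c a b : R := a * (b * fine (covariance P (Yp d) D) +
                       (1 - b) * fine (covariance P (Yp d) Z)).
have lower a b : c a b <= 0 ->
    ('E_P[f_lower (yl d) (yu d) d (observed T D Yp) D (deltaS_plus D Z (a, b))]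
      <= 'E_P[Yp d])%E.
  move=> c0; apply: le_trans (f_lower_expectation_le D dT Yd_bounded _) _.
    exact: deltaS_plus_Lfun1.
  rewrite (deltaS_plus_expectation Yd_bounded)// -[leRHS]adde0 leeD2l// lee_fin.
have upper a b : 0 <= c a b -> ('E_P[Yp d] <=
    'E_P[f_upper (yl d) (yu d) d (observed T D Yp) D (deltaS_plus D Z (a, b))])%E.
  move=> c0; apply: le_trans (f_upper_expectation_ge D dT Yd_bounded _).
    by rewrite (deltaS_plus_expectation Yd_bounded)// leeDl// lee_fin.
  exact: deltaS_plus_Lfun1.
have sgn (a b x y : R) : 0 <= a -> 0 <= b <= 1 -> 0 <= x -> 0 <= y ->
    0 <= a * (b * x + (1 - b) * y).
  move=> a0 /andP[b0 b1] x0 y0; rewrite mulr_ge0// addr_ge0// mulr_ge0//.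
  by rewrite subr_ge0.
have := SDC _ dT.
rewrite -[covariance P (Yp d) D]fineK ?covariance_fin_num ?LYX//.
rewrite -[covariance P (Yp d) Z]fineK ?covariance_fin_num ?LYX//.
rewrite -EFinM lee_fin => /mul_ge0_same_sign[] [cD cZ]; [left|right].
(* Nonnegative covariances: [deltaS_minus] shifts the mean down and so gives lower bounds,
   [deltaS_plus] shifts it up and gives upper bounds. *)
- rewrite /I_SDC1/= in_itv/=; apply/andP; split.
  + apply/ereal_supP => y [[a b]] [].
    rewrite /= !in_itv/= => /andP[a0 _] b01 <-; rewrite deltaS_minusE; apply: lower.
    by rewrite /c mulNr oppr_le0; exact: sgn.
  + apply/ereal_infP => y [[a b]] [].
    rewrite /= !in_itv/= => /andP[a0 _] b01 <-; apply: upper.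
    exact: sgn.
(* Nonpositive covariances: the two weights exchange roles, and [sgn] is applied to the opposites of
   the covariances. *)
- rewrite /I_SDC2/= in_itv/=; apply/andP; split.
  + apply/ereal_supP => y [[a b]] [].
    rewrite /= !in_itv/= => /andP[a0 _] b01 <-; apply: lower.
    rewrite /c -oppr_ge0 -mulrN opprD -!mulrN.
    by apply: sgn; rewrite ?oppr_ge0.
  + apply/ereal_infP => y [[a b]] [].
    rewrite /= !in_itv/= => /andP[a0 _] b01 <-; rewrite deltaS_minusE; apply: upper.
    rewrite /c mulNr -mulrN opprD -!mulrN.
    by apply: sgn; rewrite ?oppr_ge0.
Qed.
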